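(* Let $\Sigma$, $\rho$, $E(x,y)$, $\mathbb Q$, $\mathbb{IQ}$ and $\mathcal I$ be as in the context. Then: (i) for each $J\in\mathbb{IQ}$ and each $f\in\Sigma$, the set $C(J)=\{x\in J\mid\nabla x=x=\Delta x\}$ is closed under $f^J$; (ii) the assignment $\mathcal C\colon\mathbb{IQ}\to\mathbb Q$ sending $J$ to the $\Sigma$-algebra $\mathcal C(J)$ with universe $C(J)$ and operations $f^J$ restricted to $C(J)$, and sending a homomorphism $g\colon J\to K$ to its restriction to $C(J)$, is a well-defined faithful functor (in particular $\mathcal C(J)\in\mathbb Q$); (iii) for each $A\in\mathbb Q$ the map $\iota_A\colon A\to\mathcal C(\mathcal I(A))$, $\iota_A(a)=[a,a]$, is an isomorphism, and $A\mapsto\iota_A$ is a natural isomorphism from the identity functor of $\mathbb Q$ to $\mathcal C\circ\mathcal I$; (iv) for each $J\in\mathbb{IQ}$ the map $\gamma_J\colon J\to\mathcal I(\mathcal C(J))$, $\gamma_J(a)=[\Delta a,\nabla a]$, is a one-to-one homomorphism, and $J\mapsto\gamma_J$ is a natural transformation from the identity functor of $\mathbb{IQ}$ to $\mathcal I\circ\mathcal C$.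
   Context: $\Sigma$ is a set of constant and function symbols containing constants $0,1$. A polarity $\rho$ assigns to each $n$-ary function symbol $f\in\Sigma$ a tuple $\rho(f)\in\{+,-\}^n$. A $\rho$-poalgebra is a pair $(A,\leq)$ with $A$ a $\Sigma$-algebra and $\leq$ a partial order on $A$ such that each $f^A$ is monotone in its $k$-th argument if $\rho(f)_k=+$ and antitone if $\rho(f)_k=-$; it is bounded if $0^A\leq a\leq 1^A$ for all $a$. For a bounded $\rho$-poalgebra $A$, $\mathcal I(A)$ is the $(\Sigma\cup\{\Delta,\nabla,\iota\})$-algebra on $I(A)=\{[a,b]\mid a\leq b\}$ with $f^{\mathcal I(A)}([a_1,b_1],\dots,[a_n,b_n])=[f^A(c_1,\dots,c_n),f^A(d_1,\dots,d_n)]$, where $c_k=a_k,d_k=b_k$ if $\rho(f)_k=+$ and $c_k=b_k,d_k=a_k$ if $\rho(f)_k=-$, $\Delta[a,b]=[a,a]$, $\nabla[a,b]=[b,b]$, $\iota=[0^A,1^A]$. A set $E(x,y)$ of $\Sigma$-equations determines the order of $A$ if $a\leq b$ iff $t^A(a,b)=s^A(a,b)$ for all $t=s$ in $E(x,y)$. Standing assumptions: $\mathbb Q$ is a $\Sigma$-quasivariety of bounded $\rho$-poalgebras whose order is determined by a fixed set $E(x,y)$ of $\Sigma$-equations; $\mathbb{IQ}$ is the quasivariety generated by $\{\mathcal I(A)\mid A\in\mathbb Q\}$; both are categories with homomorphisms. $\mathcal I\colon\mathbb Q\to\mathbb{IQ}$ is the functor $A\mapsto\mathcal I(A)$, $h\mapsto\mathcal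 I(h)$ with $\mathcal I(h)([a,b])=[h(a),h(b)]$. *)

(* Defs.v *)
From mathcomp Require Import all_boot.
From mathcomp Require Import boolp.

Set Implicit Arguments.
Unset Strict Implicit.
Unset Printing Implicit Defensive.

Record signature := Signature {
  csym : Type;
  fsym : Type;
  ar : fsym -> nat }.

Record algebra (S : signature) := Algebra {
  carrier :> Type;
  cst : csym S -> carrier;
  op : forall f : fsym S, ('I_(ar f) -> carrier) -> carrier }.

Arguments cst {S} A c : rename.
Arguments op {S} A f a : rename.

Record is_hom (S : signature) (A B : algebra S) (h : A -> B) : Prop := IsHom {
  hom_cst : forall c, h (cst A c) = cst B c;
  hom_op : forall f (a : 'I_(ar f) -> A),
    h (op A f a) = op B f (fun k => h (a k)) }.

Record hom (S : signature) (A B : algebra S) := Hom {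
  hfun :> A -> B;
  homP : is_hom hfun }.

Inductive term (S : signature) (V : Type) : Type :=
  | Var of V
  | Cst of csym S
  | App (f : fsym S) of ('I_(ar f) -> term S V).

Fixpoint eval (S : signature) (V : Type) (A : algebra S) (v : V -> A)
    (t : term S V) : A :=
  match t with
  | Var x => v x
  | Cst c => cst A c
  | App f ts => op A f (fun k => eval v (ts k))
  end.

Definition equation (S : signature) (V : Type) : Type :=
  (term S V * term S V)%type.

Definition holds (S : signature) (V : Type) (A : algebra S) (v : V -> A)
    (e : equation S V) : Prop :=
  eval v e.1 = eval v e.2.

Record quasiequation (S : signature) := Quasiequation {
  npremises : nat;
  premise : 'I_npremises -> equation S nat;
  conclusion : equation S nat }.

Definition satisfies (S : signature) (A : algebra S) (q : quasiequation S) :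
    Prop :=
  forall v : nat -> A,
    (forall i, holds v (premise (q := q) i)) -> holds v (conclusion q).

Definition quasivariety (S : signature) (K : algebra S -> Prop) : Prop :=
  exists T : quasiequation S -> Prop,
    forall A, K A <-> (forall q, T q -> satisfies A q).

Definition generated_quasivariety (S : signature) (K : algebra S -> Prop)
    (A : algebra S) : Prop :=
  forall V : algebra S -> Prop,
    quasivariety V -> (forall B, K B -> V B) -> V A.

Record obj (S : signature) (K : algebra S -> Prop) := Obj {
  oalg :> algebra S;
  objP : K oalg }.

Lemma is_hom_id (S : signature) (A : algebra S) : @is_hom S A A (fun x => x).
Proof. by []. Qed.

Lemma is_hom_comp (S : signature) (A B C : algebra S) (g : hom B C)
  (h : hom A B) : is_hom (fun x => g (h x)).
Proof.
split=> [c|f a]; first by rewrite (hom_cst (homP h)) (hom_cst (homP g)).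
by rewrite (hom_op (homP h)) (hom_op (homP g)).
Qed.

Definition hid (S : signature) (A : algebra S) : hom A A := Hom (is_hom_id A).

Definition hcomp (S : signature) (A B C : algebra S) (g : hom B C)
  (h : hom A B) : hom A C := Hom (is_hom_comp g h).

Lemma homE (S : signature) (A B : algebra S) (g h : hom A B) :
  (forall x, g x = h x) -> g = h.
Proof.
case: g h => [g gP] [h hP] /= gh.
have {}gh : g = h by apply: funext.
by subst h; congr Hom; apply: Prop_irrelevance.
Qed.

Definition isomorphism (S : signature) (A B : algebra S) (h : hom A B) : Prop :=
  exists k : hom B A, hcomp k h = hid A /\ hcomp h k = hid B.

Record functor_data (S T : signature)
    (K : algebra S -> Prop) (L : algebra T -> Prop) := FunctorData {
  fobj :> obj K -> obj L;
  fmap : forall A B : obj K, hom A B -> hom (fobj A) (fobj B) }.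

Record is_functor (S T : signature)
    (K : algebra S -> Prop) (L : algebra T -> Prop)
    (F : functor_data K L) : Prop := IsFunctor {
  fmap_id : forall A : obj K, fmap F (hid A) = hid (F A);
  fmap_comp : forall (A B C : obj K) (g : hom B C) (h : hom A B),
    fmap F (hcomp g h) = hcomp (fmap F g) (fmap F h) }.

Definition faithful (S T : signature)
    (K : algebra S -> Prop) (L : algebra T -> Prop)
    (F : functor_data K L) : Prop :=
  forall (A B : obj K) (g h : hom A B), fmap F g = fmap F h -> g = h.

Definition id_functor (S : signature) (K : algebra S -> Prop) :
    functor_data K K :=
  @FunctorData S S K K (fun A => A) (fun A B h => h).

Definition comp_functor (S T U : signature) (K : algebra S -> Prop)
    (L : algebra T -> Prop) (M : algebra U -> Prop)
    (G : functor_data L M) (F : functor_data K L) : functor_data K M :=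
  @FunctorData S U K M (fun A => G (F A)) (fun A B h => fmap G (fmap F h)).

Definition natural (S T : signature)
    (K : algebra S -> Prop) (L : algebra T -> Prop)
    (F G : functor_data K L) (tau : forall A : obj K, hom (F A) (G A)) : Prop :=
  forall (A B : obj K) (h : hom A B),
    hcomp (tau B) (fmap F h) = hcomp (fmap G h) (tau A).

Record bsignature := BSignature {
  bsig :> signature;
  czero : csym bsig;
  cone : csym bsig;
  czero_neq_cone : czero <> cone }.

(* true stands for +, false for -. *)
Definition polarity (S : signature) := forall f : fsym S, 'I_(ar f) -> bool.

Record bounded_poalgebra (S : bsignature) (rho : polarity S) (A : algebra S)
    (le : A -> A -> Prop) : Prop := BoundedPoalgebra {
  po_refl : forall a, le a a;
  po_anti : forall a b, le a b -> le b a -> a = b;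
  po_trans : forall a b c, le a b -> le b c -> le a c;
  po_mono : forall f (k : 'I_(ar f)) (a b : 'I_(ar f) -> A),
    (forall j, j != k -> a j = b j) -> le (a k) (b k) ->
    if rho f k then le (op A f a) (op A f b) else le (op A f b) (op A f a);
  po_ge0 : forall a, le (cst A (czero S)) a;
  po_le1 : forall a, le a (cst A (cone S)) }.

Inductive xy := vx | vy.

Definition valxy (A : Type) (a b : A) (w : xy) : A :=
  match w with vx => a | vy => b end.

Definition eq_le (S : signature) (E : equation S xy -> Prop) (A : algebra S)
    (a b : A) : Prop :=
  forall e, E e -> holds (valxy a b) e.

Arguments eq_le {S} E A a b.

Definition determines_order (S : signature) (E : equation S xy -> Prop)
    (A : algebra S) (le : A -> A -> Prop) : Prop :=
  forall a b, le a b <-> eq_le E A a b.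

Definition poalgebras_ordered_by (S : bsignature) (rho : polarity S)
    (E : equation S xy -> Prop) (Q : algebra S -> Prop) : Prop :=
  forall A, Q A ->
    exists le : A -> A -> Prop,
      bounded_poalgebra rho le /\ determines_order E le.

Inductive ecsym (S : signature) := ECst of csym S | EIota.
Inductive efsym (S : signature) := EFun of fsym S | EDelta | ENabla.

Arguments EIota {S}.
Arguments EDelta {S}.
Arguments ENabla {S}.

Definition ext_sig (S : signature) : signature :=
  @Signature (ecsym S) (efsym S)
    (fun f => match f with EFun f => ar f | EDelta | ENabla => 1 end).

Definition ocst (S : signature) (J : algebra (ext_sig S)) (c : csym S) : J :=
  @cst (ext_sig S) J (ECst c).
Definition oop (S : signature) (J : algebra (ext_sig S)) (f : fsym S)
    (a : 'I_(ar f) -> J) : J :=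
  @op (ext_sig S) J (EFun f) a.
Definition Delta (S : signature) (J : algebra (ext_sig S)) (x : J) : J :=
  @op (ext_sig S) J EDelta (fun=> x).
Definition Nabla (S : signature) (J : algebra (ext_sig S)) (x : J) : J :=
  @op (ext_sig S) J ENabla (fun=> x).

Arguments ocst {S} J c.
Arguments oop {S} J f a.

Record interval (A : Type) (le : A -> A -> Prop) := Interval {
  lo : A;
  hi : A;
  lo_le_hi : le lo hi }.

Lemma intervalE (A : Type) (le : A -> A -> Prop) (x y : interval le) :
  lo x = lo y -> hi x = hi y -> x = y.
Proof.
case: x y => [a b ab] [c d cd] /= ac bd; subst c d.
by congr Interval; apply: Prop_irrelevance.
Qed.

Section IntervalAlgebra.
Variables (S : bsignature) (rho : polarity S) (A : algebra S).
Variables (le : A -> A -> Prop) (poA : bounded_poalgebra rho le).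

Definition lo_args (f : fsym S) (x : 'I_(ar f) -> interval le) (k : 'I_(ar f)) :=
  if rho k then lo (x k) else hi (x k).
Definition hi_args (f : fsym S) (x : 'I_(ar f) -> interval le) (k : 'I_(ar f)) :=
  if rho k then hi (x k) else lo (x k).

Lemma op_lo_le_hi (f : fsym S) (x : 'I_(ar f) -> interval le) :
  le (op A f (lo_args x)) (op A f (hi_args x)).
Proof.
pose mix m (j : 'I_(ar f)) := if j < m then hi_args x j else lo_args x j.
have mix0 : mix 0 = lo_args x by apply: funext.
have mixn : mix (ar f) = hi_args x.
  by apply: funext => j; rewrite /mix ltn_ord.
rewrite -mix0 -mixn; have := leqnn (ar f).
elim: {-2}(ar f) => [|m IH] mf; first exact: (po_refl poA).
apply: (po_trans poA (IH (ltnW mf))).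
pose k := Ordinal mf.
have neq j : j != k -> mix m j = mix m.+1 j.
  move=> jk; rewrite /mix ltnS (leq_eqVlt j m).
  by have /negPf -> : nat_of_ord j != m by apply: contra jk => /eqP jm; apply/eqP/val_inj.
have mk : mix m k = lo_args x k by rewrite /mix /= ltnn.
have mk1 : mix m.+1 k = hi_args x k by rewrite /mix /= leqnn.
have := @po_mono _ _ _ _ poA f k (mix m) (mix m.+1) neq.
have := @po_mono _ _ _ _ poA f k (mix m.+1) (mix m)
  (fun j jk => esym (neq j jk)).
rewrite mk mk1 /lo_args /hi_args; case: (rho k) => H1 H2.
  by apply: H2; apply: lo_le_hi.
by apply: H1; apply: lo_le_hi.
Qed.

Definition diag (a : A) : interval le := Interval (po_refl poA a).

Definition interval_cst (c : ecsym S) : interval le :=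
  match c with
  | ECst c => diag (cst A c)
  | EIota => Interval (po_ge0 poA (cst A (cone S)))
  end.

Definition interval_op (f : efsym S) :
    ('I_(@ar (ext_sig S) f) -> interval le) -> interval le :=
  match f with
  | EFun f => fun x => Interval (op_lo_le_hi x)
  | EDelta => fun x => diag (lo (x ord0))
  | ENabla => fun x => diag (hi (x ord0))
  end.

Definition interval_algebra : algebra (ext_sig S) :=
  @Algebra (ext_sig S) (interval le) interval_cst interval_op.

End IntervalAlgebra.

Section IntervalFunctor.
Variables (S : bsignature) (rho : polarity S).
Variables (E : equation S xy -> Prop) (Q : algebra S -> Prop).
Hypothesis ordQ : poalgebras_ordered_by rho E Q.

Lemma eq_le_poalgebra (A : obj Q) : bounded_poalgebra rho (eq_le E A).
Proof.
have [le [leP leE]] := ordQ (objP A).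
suff <- : le = eq_le E A by [].
by apply: funext => a; apply: funext => b; apply: propext.
Qed.

(* The order witnessed by ordQ is necessarily eq_le E A. *)
Definition Ialg (A : obj Q) : algebra (ext_sig S) :=
  interval_algebra (eq_le_poalgebra A).

Definition IQ : algebra (ext_sig S) -> Prop :=
  generated_quasivariety (fun B => exists A : obj Q, B = Ialg A).

Lemma Ialg_IQ (A : obj Q) : IQ (Ialg A).
Proof. by move=> V _; apply; exists A. Qed.

Lemma hom_eval (A B : algebra S) (h : hom A B) V (v : V -> A) (t : term S V) :
  h (eval v t) = eval (fun x => h (v x)) t.
Proof.
elim: t => [x|c|f ts IH] //=; first exact: (hom_cst (homP h)).
by rewrite (hom_op (homP h)); congr (op B f _); apply: funext => k; apply: IH.
Qed.

Lemma hom_eq_le (A B : algebra S) (h : hom A B) (a b : A) :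
  eq_le E A a b -> eq_le E B (h a) (h b).
Proof.
move=> ab e Ee.
have hv : valxy (h a) (h b) = (fun w => h (valxy a b w)).
  by apply: funext; case.
by rewrite /holds hv -!hom_eval (ab e Ee).
Qed.

Definition Ifun (A B : obj Q) (h : hom A B) (x : Ialg A) : Ialg B :=
  Interval (hom_eq_le h (lo_le_hi x)).

Lemma Ifun_hom (A B : obj Q) (h : hom A B) : is_hom (Ifun h).
Proof.
split=> [[c|]|[f||] a]; apply: intervalE => //=; rewrite ?(hom_cst (homP h)) //.
- rewrite (hom_op (homP h)); congr (op B f _); apply: funext => k.
  by rewrite /lo_args; case: (rho k).
- rewrite (hom_op (homP h)); congr (op B f _); apply: funext => k.
  by rewrite /hi_args; case: (rho k).
Qed.

Definition Ifunctor : functor_data Q IQ :=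
  @FunctorData S (ext_sig S) Q IQ (fun A => Obj (Ialg_IQ A))
    (fun A B h => Hom (Ifun_hom h)).

Lemma Ifunctor_is_functor : is_functor Ifunctor.
Proof. by split=> *; apply: homE => x; apply: intervalE. Qed.

End IntervalFunctor.

Section Centre.
Variable S : signature.

Definition Cset (J : algebra (ext_sig S)) (x : J) : Prop :=
  Nabla x = x /\ x = Delta x.

Definition sigma_closed (J : algebra (ext_sig S)) (X : J -> Prop) : Prop :=
  (forall c, X (ocst J c)) /\
  (forall f (a : 'I_(ar f) -> J), (forall k, X (a k)) -> X (oop J f a)).

Definition Calg (J : algebra (ext_sig S)) (clJ : sigma_closed (@Cset J)) :
    algebra S :=
  @Algebra S {x : J | Cset x}
    (fun c => exist _ (ocst J c) (clJ.1 c))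
    (fun f a => exist _ (oop J f (fun k => sval (a k)))
                        (clJ.2 f _ (fun k => svalP (a k)))).

Definition Cfun (J K : algebra (ext_sig S)) (g : J -> K)
    (gC : forall x, Cset x -> Cset (g x)) (x : {x : J | Cset x}) :
    {x : K | Cset x} :=
  exist _ (g (sval x)) (gC _ (svalP x)).

(* The arguments are exactly the well-definedness conditions on C: closure of
   C(J) under the operations, membership of C(J) in Q, and the restrictions
   being homomorphisms between the algebras C(J). *)
Definition Cfunctor (Q : algebra S -> Prop) (R : algebra (ext_sig S) -> Prop)
    (Ccl : forall J : obj R, sigma_closed (@Cset J))
    (CQ : forall J : obj R, Q (Calg (Ccl J)))
    (CC : forall (J K : obj R) (g : hom J K) (x : J), Cset x -> Cset (g x))
    (Chom : forall (J K : obj R) (g : hom J K),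
       @is_hom S (Calg (Ccl J)) (Calg (Ccl K)) (Cfun (@CC J K g))) :
    functor_data R Q :=
  @FunctorData (ext_sig S) S R Q (fun J => Obj (CQ J))
    (fun J K g => Hom (Chom J K g)).

End Centre.

(* Main.v *)
Require Import Defs.
From mathcomp Require Import all_boot.
From mathcomp Require Import boolp.

Set Implicit Arguments.
Unset Strict Implicit.
Unset Printing Implicit Defensive.

(** The degenerate intervals of I(A) form a copy of A, and Delta and Nabla
    retract I(A) onto it.  Hence a quasi-equation over Sigma about the lower
    and upper ends of finitely many intervals is a quasi-equation over the
    extended signature in those intervals, and if it holds in all I(A) then it
    holds in every J of IQ, where it speaks about C(J).  The quasi-equations
    defining Q, applied to lower ends, give C(J) in Q; the equations E, applied
    to the two ends of a single interval, give Delta a <= Nabla a in C(J).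
    Since an interval is determined by its ends, gamma is injective, and
    faithfulness of C follows from this and the naturality of gamma. *)

Lemma sval_inj (T : Type) (P : T -> Prop) : injective (@sval T P).
Proof. by move=> x y; apply: eq_sig_hprop => z; apply: Prop_irrelevance. Qed.

Lemma cancel_isomorphism (S : signature) (A B : algebra S) (h : hom A B)
    (k : B -> A) : cancel h k -> cancel k h -> isomorphism h.
Proof.
move=> hK kK; suff kP : is_hom k by exists (Hom kP); split; apply: homE.
split=> [c|f b]; first by rewrite -(hom_cst (homP h)) hK.
apply: (can_inj hK); rewrite kK (hom_op (homP h)); congr (op B f _).
by apply: funext => i; rewrite kK.
Qed.

Lemma natural_injective_faithful (S T : signature) (K : algebra S -> Prop)
    (L : algebra T -> Prop) (F : functor_data K L) (G : functor_data L K)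
    (tau : forall A : obj K, hom A (G (F A))) :
  natural (F := id_functor K) (G := comp_functor G F) tau ->
  (forall A, injective (tau A)) -> faithful F.
Proof.
move=> tau_nat tau_inj A B g h Fgh; apply: homE => x; apply: (tau_inj B).
have GFgh : hcomp (tau B) g = hcomp (tau B) h.
  by rewrite [LHS]tau_nat [RHS]tau_nat /= Fgh.
exact: (congr1 (fun k : hom A (G (F B)) => k x) GFgh).
Qed.

Lemma holds_injective_hom (S : bsignature) (A B : algebra S) (h : A -> B)
    (V : Type) (v : V -> A) (e : equation S V) :
  is_hom h -> injective h -> holds (fun x => h (v x)) e <-> holds v e.
Proof.
by move=> hP h_inj; rewrite /holds -!(hom_eval (Hom hP)); split=> [/h_inj|->].
Qed.

Section Substitution.
Variables (S : signature) (V W : Type) (sigma : V -> term S W).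

Fixpoint subst (t : term S V) : term S W :=
  match t with
  | Var x => sigma x
  | Cst c => Cst W c
  | App f ts => App (fun k => subst (ts k))
  end.

Definition subst_equation (e : equation S V) : equation S W :=
  (subst e.1, subst e.2).

Lemma eval_subst (A : algebra S) (v : W -> A) (t : term S V) :
  eval v (subst t) = eval (fun x => eval v (sigma x)) t.
Proof.
by elim: t => [x|c|f ts IH] //=; congr (op A f _); apply: funext => k.
Qed.

Lemma holds_subst (A : algebra S) (v : W -> A) (e : equation S V) :
  holds v (subst_equation e) = holds (fun x => eval v (sigma x)) e.
Proof. by rewrite /holds /= !eval_subst. Qed.

End Substitution.

Section Validity.
Variables (S : signature) (I : finType) (V : countType).
Variables (prem : I -> equation S V) (concl : equation S V).

Definition validates (A : algebra S) : Prop :=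
  forall v : V -> A, (forall i, holds v (prem i)) -> holds v concl.

Definition nat_equation : equation S V -> equation S nat :=
  subst_equation (fun x => Var S (pickle x)).

Lemma holds_nat_equation (A : algebra S) (w : nat -> A) (e : equation S V) :
  holds w (nat_equation e) = holds (fun x => w (pickle x)) e.
Proof. exact: holds_subst. Qed.

Definition nat_quasiequation : quasiequation S :=
  Quasiequation (fun i : 'I_#|I| => nat_equation (prem (enum_val i)))
    (nat_equation concl).

Lemma satisfies_nat_quasiequation (A : algebra S) :
  satisfies A nat_quasiequation <-> validates A.
Proof.
split=> [satA v vprem|valA w wprem]; last first.
  rewrite holds_nat_equation; apply: valA => i; have := wprem (enum_rank i).
  by rewrite holds_nat_equation enum_rankK.
(* A value of a term witnesses that A is inhabited. *)
pose w n := oapp v (eval v concl.1) (unpickle n).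
have w_pickle : (fun x => w (pickle x)) = v.
  by apply: funext => x; rewrite /w pickleK.
have := satA w; rewrite holds_nat_equation w_pickle; apply=> i.
by rewrite holds_nat_equation w_pickle.
Qed.

Lemma quasivariety_validates : quasivariety validates.
Proof.
exists (eq nat_quasiequation) => A; rewrite -satisfies_nat_quasiequation.
by split=> [satA _ <- //|]; apply.
Qed.

Lemma generated_quasivariety_validates (K : algebra S -> Prop) (A : algebra S) :
  (forall B, K B -> validates B) -> generated_quasivariety K A -> validates A.
Proof. by move=> KV genA; apply: genA => //; apply: quasivariety_validates. Qed.

End Validity.

Section Reduct.
Variable S : signature.
Implicit Type J : algebra (ext_sig S).

Definition reduct J : algebra S := Algebra (ocst J) (@oop S J).

Fixpoint ext_term (V : Type) (t : term S V) : term (ext_sig S) V :=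
  match t with
  | Var x => Var (ext_sig S) x
  | Cst c => @Cst (ext_sig S) V (ECst c)
  | App f ts => @App (ext_sig S) V (EFun f) (fun k => ext_term (ts k))
  end.

Definition ext_equation (V : Type) (e : equation S V) :
    equation (ext_sig S) V :=
  (ext_term e.1, ext_term e.2).

Lemma eval_ext_term (V : Type) J (v : V -> J) (t : term S V) :
  eval v (ext_term t) = eval (A := reduct J) v t.
Proof.
by elim: t => [x|c|f ts IH] //=; congr (oop J f _); apply: funext => k.
Qed.

Lemma holds_ext_equation (V : Type) J (v : V -> J) (e : equation S V) :
  holds v (ext_equation e) = holds (A := reduct J) v e.
Proof. by rewrite /holds /= !eval_ext_term. Qed.

Lemma sval_Calg_is_hom J (clJ : sigma_closed (@Cset S J)) :
  @is_hom S (Calg clJ) (reduct J) sval.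
Proof. by []. Qed.

End Reduct.

Section Endpoints.
Variable S : signature.

Definition endpoint (b : bool) (J : algebra (ext_sig S)) (x : J) : J :=
  if b then Nabla x else Delta x.

Definition endpoint_term (b : bool) (V : Type) (t : term (ext_sig S) V) :
    term (ext_sig S) V :=
  if b then @App (ext_sig S) V ENabla (fun=> t)
  else @App (ext_sig S) V EDelta (fun=> t).

Lemma eval_endpoint_term b (V : Type) (J : algebra (ext_sig S)) (v : V -> J)
    (t : term (ext_sig S) V) :
  eval v (endpoint_term b t) = endpoint b (eval v t).
Proof. by case: b. Qed.

(* Under [p], a variable of [e] stands for an end of an interval variable. *)
Definition endpoint_equation (V W : Type) (p : W -> bool * V)
    (e : equation S W) : equation (ext_sig S) V :=
  subst_equation (fun w => endpoint_term (p w).1 (Var (ext_sig S) (p w).2))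
    (ext_equation e).

Lemma holds_endpoint_equation (V W : Type) (p : W -> bool * V)
    (J : algebra (ext_sig S)) (v : V -> J) (e : equation S W) :
  holds v (endpoint_equation p e)
  = holds (A := reduct J) (fun w => endpoint (p w).1 (v (p w).2)) e.
Proof.
rewrite holds_subst holds_ext_equation; congr holds.
by apply: funext => w; apply: eval_endpoint_term.
Qed.

Lemma Cset_endpoint (J : algebra (ext_sig S)) (x : J) :
  Cset x <-> forall b, endpoint b x = x.
Proof.
split=> [[nx dx] []|xE]; [exact: nx|exact: esym dx|].
by split; [exact: (xE true)|exact/esym/(xE false)].
Qed.

Lemma hom_endpoint b (J K : algebra (ext_sig S)) (g : hom J K) (x : J) :
  g (endpoint b x) = endpoint b (g x).
Proof. by case: b; apply: (hom_op (homP g)). Qed.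

Lemma hom_Cset (J K : algebra (ext_sig S)) (g : hom J K) (x : J) :
  Cset x -> Cset (g x).
Proof. by rewrite !Cset_endpoint => xE b; rewrite -hom_endpoint xE. Qed.

Lemma Cfun_is_hom (J K : algebra (ext_sig S)) (clJ : sigma_closed (@Cset S J))
    (clK : sigma_closed (@Cset S K)) (g : hom J K) :
  @is_hom S (Calg clJ) (Calg clK) (Cfun (@hom_Cset J K g)).
Proof.
split=> [c|f a]; apply: sval_inj; first exact: (hom_cst (homP g)).
exact: (hom_op (homP g)).
Qed.

End Endpoints.

Definition bound (A : Type) (le : A -> A -> Prop) (b : bool) (x : interval le)
    : A :=
  if b then hi x else lo x.

Lemma bound_ext (A : Type) (le : A -> A -> Prop) (x y : interval le) :
  (forall b, bound b x = bound b y) -> x = y.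
Proof. by move=> xy; exact: intervalE (xy false) (xy true). Qed.

Section IntervalAlgebra.
Variables (S : bsignature) (rho : polarity S) (A : algebra S).
Variables (le : A -> A -> Prop) (poA : bounded_poalgebra rho le).

Local Notation IA := (interval_algebra poA).
Local Notation dg := (diag poA).

(* An antitone argument contributes its opposite end. *)
Lemma bound_oop b f (x : 'I_(ar f) -> IA) :
  bound b (oop IA f x) = op A f (fun k => bound (b == rho k) (x k)).
Proof.
by case: b => /=; congr (op A f _); apply: funext => k;
  rewrite /lo_args /hi_args; case: (rho k).
Qed.

Lemma bound_diag b (a : A) : bound b (dg a) = a.
Proof. by case: b. Qed.

Lemma diag_inj : injective dg.
Proof. by move=> a b /(congr1 (bound true)). Qed.

Lemma diag_is_hom : @is_hom S A (reduct IA) dg.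
Proof.
split=> // f a; apply: bound_ext => b; rewrite bound_diag bound_oop.
by congr (op A f _); apply: funext => k; rewrite bound_diag.
Qed.

Lemma endpoint_interval b (x : IA) : endpoint b x = dg (bound b x).
Proof. by case: b. Qed.

Lemma holds_endpoint_equation_interval (V W : Type) (p : W -> bool * V)
    (v : V -> IA) (e : equation S W) :
  holds v (endpoint_equation p e)
  <-> holds (fun w => bound (p w).1 (v (p w).2)) e.
Proof.
rewrite holds_endpoint_equation (funext (fun w => endpoint_interval _ _)).
exact: (holds_injective_hom _ e diag_is_hom diag_inj).
Qed.

Lemma Cset_diag (a : A) : @Cset S IA (dg a).
Proof. by apply/Cset_endpoint => b; rewrite endpoint_interval bound_diag. Qed.

Section Iota.
Variable clI : sigma_closed (@Cset S IA).

Definition iota_fun (a : A) : Calg clI := exist _ (dg a) (Cset_diag a).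

Lemma iota_is_hom : is_hom iota_fun.
Proof.
split=> [c|f a]; apply: sval_inj; first exact: (hom_cst diag_is_hom).
exact: (hom_op diag_is_hom).
Qed.

Definition iota_hom : hom A (Calg clI) := Hom iota_is_hom.

Lemma iota_isomorphism : isomorphism iota_hom.
Proof.
pose inv (x : Calg clI) : A := lo (sval x).
apply: (@cancel_isomorphism _ _ _ iota_hom inv) => // x.
apply: sval_inj; have /Cset_endpoint/(_ false) := svalP x.
by rewrite endpoint_interval.
Qed.

End Iota.

End IntervalAlgebra.

Section IntervalQuasivariety.
Variables (S : bsignature) (rho : polarity S).
Variables (E : equation S xy -> Prop) (Q : algebra S -> Prop).
Hypothesis ordQ : poalgebras_ordered_by rho E Q.

Section Member.
Variable J : obj (IQ ordQ).

Lemma IQ_validates (I : finType) (V : countType)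
    (prem : I -> equation (ext_sig S) V) (concl : equation (ext_sig S) V) :
  (forall A : obj Q, validates prem concl (Ialg ordQ A)) ->
  validates prem concl J.
Proof.
by move=> valA; apply: generated_quasivariety_validates (objP J) => _ [A ->].
Qed.

Lemma IQ_identity (V : countType) (s t : term (ext_sig S) V) :
  (forall (A : obj Q) (v : V -> Ialg ordQ A), eval v s = eval v t) ->
  forall v : V -> J, eval v s = eval v t.
Proof.
move=> st v.
by apply: (@IQ_validates void V (fun=> (s, t)) (s, t)) => [A u _|[]]; apply: st.
Qed.

Lemma endpoint_endpoint b c (x : J) :
  endpoint b (endpoint c x) = endpoint c x.
Proof.
have := @IQ_identity unit (endpoint_term b (endpoint_term c (Var _ tt)))
  (endpoint_term c (Var _ tt)) _ (fun=> x).
rewrite !eval_endpoint_term; apply=> A u.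
by rewrite !eval_endpoint_term !endpoint_interval bound_diag.
Qed.

Lemma endpoint_ocst b c : endpoint b (ocst J c) = ocst J c.
Proof.
pose t := @Cst (ext_sig S) void (ECst c).
have := @IQ_identity void (endpoint_term b t) t _ (of_void J).
rewrite eval_endpoint_term; apply=> A u.
by rewrite eval_endpoint_term endpoint_interval bound_diag.
Qed.

Lemma endpoint_EIota b :
  endpoint b (@cst (ext_sig S) J EIota)
  = ocst J (if b then cone S else czero S).
Proof.
have := @IQ_identity void (endpoint_term b (@Cst (ext_sig S) void EIota))
  (@Cst (ext_sig S) void (ECst (if b then cone S else czero S))) _ (of_void J).
rewrite eval_endpoint_term; apply=> A u.
by rewrite eval_endpoint_term endpoint_interval; case: b.
Qed.

Lemma endpoint_oop b f (a : 'I_(ar f) -> J) :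
  endpoint b (oop J f a) = oop J f (fun k => endpoint (b == rho k) (a k)).
Proof.
pose x : 'I_(ar f) -> term (ext_sig S) 'I_(ar f) := @Var (ext_sig S) _.
pose s := endpoint_term b (@App (ext_sig S) _ (EFun f) x).
pose t := @App (ext_sig S) _ (EFun f)
  (fun k => endpoint_term (b == rho k) (x k)).
have evalt (K : algebra (ext_sig S)) (u : 'I_(ar f) -> K) :
    eval u t = oop K f (fun k => endpoint (b == rho k) (u k)).
  by congr (oop K f _); apply: funext => k; apply: eval_endpoint_term.
have := @IQ_identity _ s t _ a; rewrite evalt eval_endpoint_term; apply=> A u.
rewrite evalt eval_endpoint_term endpoint_interval bound_oop.
rewrite (hom_op (diag_is_hom _)).
by congr (oop _ f _); apply: funext => k; rewrite endpoint_interval.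
Qed.

Lemma endpoint_ext (x y : J) : (forall b, endpoint b x = endpoint b y) -> x = y.
Proof.
pose X c := Var (ext_sig S) (c : bool) => xy.
apply: (@IQ_validates bool bool
  (fun b => (endpoint_term b (X true), endpoint_term b (X false)))
  (X true, X false) _ (fun c => if c then x else y)) => [A u uE|b].
  apply: bound_ext => b; apply: (@diag_inj _ _ _ _ (eq_le_poalgebra ordQ A)).
  by have := uE b; rewrite /holds !eval_endpoint_term !endpoint_interval.
by rewrite /holds !eval_endpoint_term.
Qed.

Lemma Cset_sigma_closed : sigma_closed (@Cset S J).
Proof.
split=> [c|f a aC]; apply/Cset_endpoint => b; first exact: endpoint_ocst.
rewrite endpoint_oop; congr (oop J f _); apply: funext => k.
by have /Cset_endpoint -> := aC k.
Qed.

Local Notation CJ := (Calg Cset_sigma_closed).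

Definition Calg_endpoint b (x : J) : CJ :=
  exist _ (endpoint b x)
    ((Cset_endpoint (endpoint b x)).2 (fun c => endpoint_endpoint c b x)).

Lemma holds_endpoint_equation_Calg (V W : Type) (p : W -> bool * V)
    (v : V -> J) (e : equation S W) :
  holds v (endpoint_equation p e)
  <-> holds (fun w => Calg_endpoint (p w).1 (v (p w).2)) e.
Proof.
rewrite holds_endpoint_equation.
exact: (holds_injective_hom (fun w => Calg_endpoint (p w).1 (v (p w).2)) e
  (sval_Calg_is_hom _) (@sval_inj _ _)).
Qed.

Lemma Calg_validates_endpoints (I : finType) (V : countType) (W : Type)
    (p : W -> bool * V) (prem : I -> equation S W) (concl : equation S W) :
  (forall (A : obj Q) (v : V -> Ialg ordQ A),
     (forall i, holds (fun w => bound (p w).1 (v (p w).2)) (prem i)) ->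
     holds (fun w => bound (p w).1 (v (p w).2)) concl) ->
  forall v : V -> J,
    (forall i, holds (fun w => Calg_endpoint (p w).1 (v (p w).2)) (prem i)) ->
    holds (fun w => Calg_endpoint (p w).1 (v (p w).2)) concl.
Proof.
move=> validA v vprem; apply/holds_endpoint_equation_Calg.
apply: (@IQ_validates I V (fun i => endpoint_equation p (prem i))).
  move=> A u uprem; apply/holds_endpoint_equation_interval/validA => i.
  exact/holds_endpoint_equation_interval.
by move=> i; apply/holds_endpoint_equation_Calg.
Qed.

Lemma Calg_satisfies (q : quasiequation S) :
  (forall A : obj Q, satisfies A q) -> satisfies CJ q.
Proof.
move=> satQ v.
have -> : v = (fun n => Calg_endpoint false (sval (v n))).
  apply: funext => n; apply: sval_inj.
  by have /Cset_endpoint /(_ false) := svalP (v n).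
exact: (@Calg_validates_endpoints _ nat nat (pair false) _ _
  (fun A _ => satQ A _) (fun n => sval (v n))).
Qed.

Lemma Calg_quasivariety : quasivariety Q -> Q CJ.
Proof.
case=> T QE; apply/QE => q Tq; apply: Calg_satisfies => A.
by have /QE := objP A; apply.
Qed.

Lemma Calg_endpoint_le (x : J) :
  eq_le E CJ (Calg_endpoint false x) (Calg_endpoint true x).
Proof.
move=> e Ee.
pose p w : bool * unit := (if w is vy then true else false, tt).
have valxyE (T : Type) (g : bool -> T) :
    valxy (g false) (g true) = fun w => g (p w).1.
  by apply: funext; case.
rewrite (valxyE _ (fun b => Calg_endpoint b x)).
apply: (@Calg_validates_endpoints void unit xy p (fun=> e) e _ (fun=> x)) =>
  [A u _|[]].
by rewrite -(valxyE _ (fun b => bound b (u tt))); apply: (lo_le_hi (u tt)).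
Qed.

End Member.

Section Functors.
Hypothesis quasiQ : quasivariety Q.

Definition IQ_Cfunctor : functor_data (IQ ordQ) Q :=
  Cfunctor (fun J => Calg_quasivariety J quasiQ)
    (fun J K => Cfun_is_hom (Cset_sigma_closed J) (Cset_sigma_closed K)).

Local Notation I := (Ifunctor ordQ).
Local Notation C := IQ_Cfunctor.

Lemma IQ_Cfunctor_is_functor : is_functor C.
Proof. by split=> *; apply: homE => x; apply: sval_inj. Qed.

Lemma iota_natural :
  natural (F := id_functor Q) (G := comp_functor C I)
    (fun A => iota_hom (Cset_sigma_closed (I A))).
Proof.
by move=> A B h; apply: homE => x; apply: sval_inj; apply: bound_ext; case.
Qed.

Definition gamma_fun (J : obj (IQ ordQ)) (x : J) : I (C J) :=
  Interval (Calg_endpoint_le x).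

Lemma bound_gamma b (J : obj (IQ ordQ)) (x : J) :
  bound b (gamma_fun x) = Calg_endpoint b x.
Proof. by case: b. Qed.

Lemma gamma_is_hom (J : obj (IQ ordQ)) : is_hom (@gamma_fun J).
Proof.
split=> [[c|]|[f||] a]; apply: bound_ext => b; apply: sval_inj;
  rewrite bound_gamma.
- by rewrite [LHS]endpoint_ocst; case: b.
- by rewrite [LHS]endpoint_EIota; case: b.
- rewrite [LHS]endpoint_oop [in RHS]bound_oop; congr (oop J f _).
  by apply: funext => k; rewrite bound_gamma.
all: have -> : a = fun=> a ord0 by apply: funext => k; rewrite ord1.
- by rewrite [LHS](endpoint_endpoint b false); case: b.
- by rewrite [LHS](endpoint_endpoint b true); case: b.
Qed.

Definition gamma_hom (J : obj (IQ ordQ)) : hom J (I (C J)) :=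
  Hom (@gamma_is_hom J).

Lemma gamma_injective (J : obj (IQ ordQ)) : injective (gamma_hom J).
Proof.
move=> x y xy; apply: endpoint_ext => b.
by have /(congr1 (fun z => sval (bound b z))) := xy; rewrite !bound_gamma.
Qed.

Lemma gamma_natural :
  natural (F := id_functor (IQ ordQ)) (G := comp_functor I C) gamma_hom.
Proof.
move=> J K g; apply: homE => x; apply: bound_ext => b; apply: sval_inj.
by have := hom_endpoint b g x; case: b.
Qed.

Lemma IQ_Cfunctor_faithful : faithful C.
Proof. exact: natural_injective_faithful gamma_natural gamma_injective. Qed.

End Functors.

End IntervalQuasivariety.

Theorem theorem8p7 (S : bsignature) (rho : polarity S)
    (E : equation S xy -> Prop) (Q : algebra S -> Prop)
    (quasiQ : quasivariety Q) (ordQ : poalgebras_ordered_by rho E Q) :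
  let I : functor_data Q (IQ ordQ) := Ifunctor ordQ in
  (* (i) *)
  exists Ccl : (forall J : obj (IQ ordQ), sigma_closed (@Cset S J)),
  (* (ii) *)
  exists (CQ : forall J : obj (IQ ordQ), Q (Calg (Ccl J)))
         (CC : forall (J K : obj (IQ ordQ)) (g : hom J K) (x : J),
                 Cset x -> Cset (g x))
         (Chom : forall (J K : obj (IQ ordQ)) (g : hom J K),
            @is_hom S (Calg (Ccl J)) (Calg (Ccl K)) (Cfun (CC J K g))),
  let C : functor_data (IQ ordQ) Q := Cfunctor CQ Chom in
  [/\ is_functor C,
      faithful C,
      (* (iii) *)
      exists iota : forall A : obj Q, hom A (C (I A)),
        [/\ forall (A : obj Q) (a : A),
              sval (iota A a) = diag (eq_le_poalgebra ordQ A) a,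
            forall A : obj Q, isomorphism (iota A)
          & natural (F := id_functor Q) (G := comp_functor C I) iota]
      (* (iv) *)
    & exists gamma : forall J : obj (IQ ordQ), hom J (I (C J)),
        [/\ forall (J : obj (IQ ordQ)) (a : J),
              sval (lo (gamma J a)) = Delta a /\
              sval (hi (gamma J a)) = Nabla a,
            forall J : obj (IQ ordQ), injective (gamma J)
          & natural (F := id_functor (IQ ordQ)) (G := comp_functor I C) gamma]].
Proof.
move=> I; exists (@Cset_sigma_closed S rho E Q ordQ).
exists (fun J => Calg_quasivariety J quasiQ), (fun J K => @hom_Cset S J K).
exists (fun J K => Cfun_is_hom (Cset_sigma_closed J) (Cset_sigma_closed K)).
split.
- exact: IQ_Cfunctor_is_functor.
- exact: IQ_Cfunctor_faithful.
- exists (fun A => iota_hom (Cset_sigma_closed (I A))).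
  by split=> // [A|]; [exact: iota_isomorphism|exact: iota_natural].
- exists (gamma_hom quasiQ).
  by split=> //; [exact: gamma_injective|exact: gamma_natural].
Qed.
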